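(* Let $\mathcal{C}=(S,\Delta,r)$ be a semimatroid, and let $M$ be the matroid on $S$ with rank function $r'(\sigma)=\max\{r(\tau):\tau\subseteq\sigma,\ \tau\in\Delta\}$. Then $\Delta$ is a strong pseudo-independence complex over $M$.
   Context: A semimatroid is a triple $(S,\Delta,r)$ with $S$ finite, $\Delta$ a non-void simplicial complex over $S$ (family of subsets of $S$ closed under subsets), and $r:\Delta\to\mathbb{N}$ such that for all $\sigma,\tau\in\Delta$: (i) $0\le r(\sigma)\le|\sigma|$; (ii) $\sigma\subseteq\tau\Rightarrow r(\sigma)\le r(\tau)$; (iii) if $\sigma\cup\tau\in\Delta$ then $r(\sigma)+r(\tau)\ge r(\sigma\cup\tau)+r(\sigma\cap\tau)$; (iv) if $r(\sigma)=r(\sigma\cap\tau)$ then $\sigma\cup\tau\in\Delta$; (v) if $r(\sigma)<r(\tau)$ there is $y\in\tau\setminus\sigma$ with $\sigma\cup\{y\}\in\Delta$. Let $M$ be a matroid on $S$ with rank function $\rho$, and $\Delta$ a simplicial complex over $S$. $\Delta$ is a pseudo-independence complex over $M$ if whenever $\sigma\in\Delta$, $x\in S\setminus\sigma$ and $\rho(\sigma\cup\{x\})>\rho(\sigma)$, then $\sigma\cup\{x\}\in\Delta$. It is a strong pseudo-independence complex over $M$ if in addition, whenever $\sigma\in\Delta$, $x\in S\setminus\sigma$, $\rho(\sigma\cup\{x\})=\rho(\sigma)$ and $\sigma\cup\{x\}\in\Delta$, then $x$ is a cone point of $\mathrm{lk}_\sigma(\Delta)=\{\tau:\tau\cap\sigma=\emptyset,\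 \tau\cup\sigma\in\Delta\}$, i.e. $\tau\cup\{x\}\in\mathrm{lk}_\sigma(\Delta)$ for every $\tau\in\mathrm{lk}_\sigma(\Delta)$. *)

(* Defs.v *)
From mathcomp Require Import all_boot.

Set Implicit Arguments.
Unset Strict Implicit.
Unset Printing Implicit Defensive.

(* The ground set S is the finite type T. The void complex set0 is allowed. *)
Definition simplicial_complex (T : finType) (D : {set {set T}}) : Prop :=
  forall s t : {set T}, s \subset t -> t \in D -> s \in D.

Definition link (T : finType) (D : {set {set T}}) (s : {set T}) :
    {set {set T}} :=
  [set t : {set T} | (t :&: s == set0) && (t :|: s \in D)].

Definition cone_point (T : finType) (D : {set {set T}}) (x : T) : Prop :=
  forall t : {set T}, t \in D -> x |: t \in D.

Record matroid (T : finType) : Type := Matroid {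
  mrank : {set T} -> nat;
  mrank_le_card : forall s, mrank s <= #|s|;
  mrank_mono : forall s t : {set T}, s \subset t -> mrank s <= mrank t;
  mrank_submod : forall s t : {set T},
    mrank (s :|: t) + mrank (s :&: t) <= mrank s + mrank t
}.

(* srank is total, but only its values on sfaces are constrained or used. *)
Record semimatroid (T : finType) : Type := Semimatroid {
  sfaces : {set {set T}};
  srank : {set T} -> nat;
  sfaces_nonvoid : sfaces != set0;
  sfaces_complex : simplicial_complex sfaces;
  srank_le_card : forall s, s \in sfaces -> srank s <= #|s|;
  srank_mono : forall s t, s \in sfaces -> t \in sfaces ->
    s \subset t -> srank s <= srank t;
  srank_submod : forall s t, s \in sfaces -> t \in sfaces ->
    s :|: t \in sfaces ->
    srank (s :|: t) + srank (s :&: t) <= srank s + srank t;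
  sfaces_union : forall s t, s \in sfaces -> t \in sfaces ->
    srank s = srank (s :&: t) -> s :|: t \in sfaces;
  sfaces_augment : forall s t, s \in sfaces -> t \in sfaces ->
    srank s < srank t -> exists2 y, y \in t :\: s & y |: s \in sfaces
}.

Definition pseudo_independence_complex (T : finType) (M : matroid T)
    (D : {set {set T}}) : Prop :=
  simplicial_complex D /\
  forall (s : {set T}) (x : T), s \in D -> x \notin s ->
    mrank M s < mrank M (x |: s) -> x |: s \in D.

Definition strong_pseudo_independence_complex (T : finType) (M : matroid T)
    (D : {set {set T}}) : Prop :=
  pseudo_independence_complex M D /\
  forall (s : {set T}) (x : T), s \in D -> x \notin s ->
    mrank M (x |: s) = mrank M s -> x |: s \in D ->
    cone_point (link D s) x.

(* The maximum is over a nonempty family, since set0 is a face. *)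
Definition extended_rank (T : finType) (C : semimatroid T) (s : {set T}) : nat :=
  \max_(t : {set T} | (t \subset s) && (t \in sfaces C)) srank C t.

Section ExtendedRankMatroid.

Variables (T : finType) (C : semimatroid T).
Local Notation D := (sfaces C).
Local Notation r := (srank C).
Local Notation r' := (extended_rank C).

Lemma sfaces0 : set0 \in D.
Proof.
have /set0Pn[s Ds] := sfaces_nonvoid C.
exact: sfaces_complex (sub0set s) Ds.
Qed.

Lemma extended_rank_ge (s t : {set T}) : t \subset s -> t \in D -> r t <= r' s.
Proof.
by move=> ts Dt; apply: (bigmax_sup t) => //; rewrite ts Dt.
Qed.

Lemma extended_rank_witness (s : {set T}) :
  exists t : {set T}, [/\ t \subset s, t \in D & r' s = r t].
Proof.
have [|t /andP[ts Dt] e] :=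
  @eq_bigmax_cond _ [pred t : {set T} | (t \subset s) && (t \in D)] r.
  by apply/card_gt0P; exists set0; rewrite inE /= sub0set sfaces0.
by exists t; split.
Qed.

Lemma extended_rank_le_card s : r' s <= #|s|.
Proof.
apply/bigmax_leqP => t /andP[ts Dt].
exact: leq_trans (srank_le_card Dt) (subset_leq_card ts).
Qed.

Lemma extended_rank_mono (s t : {set T}) : s \subset t -> r' s <= r' t.
Proof.
move=> st; apply/bigmax_leqP => u /andP[us Du].
exact: extended_rank_ge (subset_trans us st) Du.
Qed.

Lemma srank_augment (s t : {set T}) : s \in D -> t \in D -> r s < r t ->
  exists y, [/\ y \in t, y |: s \in D & r s < r (y |: s)].
Proof.
move=> Ds Dt lt_st.
pose P := [pred w : {set T} |
  [&& s \subset w, w \in D & r w == r s]].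
have Ps : P s by rewrite /= subxx Ds eqxx.
case: (arg_maxnP (fun w : {set T} => #|w|) Ps) => w /and3P[sw Dw /eqP rw] wmax.
have [|y /setDP[ty wy] Dyw] := sfaces_augment Dw Dt; first by rewrite rw.
have Dys : y |: s \in D by apply: sfaces_complex Dyw; apply: setUS.
exists y; split=> //; rewrite ltnNge; apply/negP => le_ys.
have eU : w :|: (y |: s) = y |: w.
  by rewrite setUCA (setUidPl sw).
have eI : w :&: (y |: s) = s.
  rewrite setIUr (setIidPr sw); apply/setUidPr/subsetP => z.
  by rewrite !inE => /andP[wz /eqP zy]; rewrite -zy wz in wy.
have := srank_submod Dw Dys; rewrite eU eI rw => /(_ Dyw) sub.
have le_yw : r (y |: w) <= r s.
  by rewrite -(leq_add2r (r s)) (leq_trans sub) // leq_add2l.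
have ge_yw : r s <= r (y |: w).
  by rewrite -rw; apply: srank_mono => //; apply: subsetUr.
have Pyw : P (y |: w).
  by rewrite /= (subset_trans sw (subsetUr _ _)) Dyw eqn_leq le_yw ge_yw.
by have := wmax _ Pyw; rewrite /= cardsU1 wy add1n ltnn.
Qed.

Lemma srank_extend (s t : {set T}) : s \in D -> t \in D ->
  exists w : {set T}, [/\ s \subset w, w \subset s :|: t, w \in D & r t <= r w].
Proof.
move=> Ds Dt.
pose P := [pred w : {set T} |
  [&& s \subset w, w \subset s :|: t & w \in D]].
have Ps : P s by rewrite /= subxx subsetUl Ds.
case: (arg_maxnP r Ps) => w /and3P[sw wst Dw] wmax.
exists w; split=> //; rewrite leqNgt; apply/negP => lt_wt.
have [y [ty Dyw lt_yw]] := srank_augment Dw Dt lt_wt.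
have Pyw : P (y |: w).
  by rewrite /= (subset_trans sw (subsetUr _ _)) subUset sub1set inE ty orbT wst.
by have := wmax _ Pyw; rewrite /= leqNgt lt_yw.
Qed.

Lemma extended_rank_submod (s t : {set T}) :
  r' (s :|: t) + r' (s :&: t) <= r' s + r' t.
Proof.
have [u [ust Du ->]] := extended_rank_witness (s :|: t).
have [v [vst Dv ->]] := extended_rank_witness (s :&: t).
have [w [vw wvu Dw le_uw]] := srank_extend Dv Du.
have wst : w \subset s :|: t.
  apply: subset_trans wvu _; rewrite subUset ust andbT.
  exact: subset_trans vst (subset_trans (subsetIl _ _) (subsetUl _ _)).
have Dws : w :&: s \in D by apply: sfaces_complex Dw; apply: subsetIl.
have Dwt : w :&: t \in D by apply: sfaces_complex Dw; apply: subsetIl.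
have eU : (w :&: s) :|: (w :&: t) = w by rewrite -setIUr (setIidPl wst).
have eI : (w :&: s) :&: (w :&: t) = w :&: (s :&: t).
  by rewrite setIACA setIid.
have Dwst : w :&: (s :&: t) \in D by apply: sfaces_complex Dw; apply: subsetIl.
have := srank_submod Dws Dwt; rewrite eU eI => /(_ Dw) sub.
apply: leq_trans (leq_add le_uw _) (leq_trans sub (leq_add _ _)).
- by apply: srank_mono => //; rewrite subsetI vw.
- by apply: extended_rank_ge => //; apply: subsetIr.
- by apply: extended_rank_ge => //; apply: subsetIr.
Qed.

Definition semimatroid_matroid : matroid T :=
  Matroid extended_rank_le_card extended_rank_mono extended_rank_submod.

End ExtendedRankMatroid.

(* Main.v *)
Require Import Defs.
From mathcomp Require Import all_boot.

(** On faces [extended_rank] agrees with [srank], so both conditions reduce to the semimatroid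
    axioms. If [x] raises the rank of [s], augmenting [s] from a face of larger rank inside [x |: s]
    can only add [x] ([sfaces_extended_rank_lt]). If [x |: s] is a face of the same rank as [s], its
    union with any face containing [s] is a face ([sfaces_union_rank_eq]); this gives the cone
    point. *)

Lemma extended_rank_face {T : finType} {C : semimatroid T} {s : {set T}} :
  s \in sfaces C -> extended_rank C s = srank C s.
Proof.
move=> Ds; apply/eqP; rewrite eqn_leq extended_rank_ge // andbT.
apply/bigmax_leqP => t /andP[ts Dt]; exact: srank_mono.
Qed.

Lemma sfaces_extended_rank_lt {T : finType} {C : semimatroid T}
    {s : {set T}} {x : T} :
  s \in sfaces C -> extended_rank C s < extended_rank C (x |: s) ->
  x |: s \in sfaces C.
Proof.
move=> Ds; rewrite extended_rank_face //.
have [t [txs Dt ->]] := extended_rank_witness C (x |: s).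
move=> /(srank_augment Ds Dt)[y [ty Dys lt_sy]].
have := subsetP txs y ty; rewrite !inE => /orP[/eqP <- // | sy].
by move: lt_sy; rewrite (setUidPr _) ?ltnn // sub1set.
Qed.

(** As [t :&: u] lies between [s] and [t], its rank is squeezed to that of [t], as [sfaces_union]
    requires. *)
Lemma sfaces_union_rank_eq {T : finType} {C : semimatroid T}
    {s t u : {set T}} :
  s \subset t -> s \subset u -> t \in sfaces C -> u \in sfaces C ->
  srank C t = srank C s -> t :|: u \in sfaces C.
Proof.
move=> st su Dt Du ets; apply: sfaces_union => //.
have Dtu : t :&: u \in sfaces C by apply: sfaces_complex Dt; apply: subsetIl.
have Ds : s \in sfaces C by apply: sfaces_complex Dt.
apply/eqP; rewrite eqn_leq {1}ets !srank_mono ?subsetIl //.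
by rewrite subsetI st.
Qed.

Theorem theorem5p2 (T : finType) (C : semimatroid T) :
  strong_pseudo_independence_complex (semimatroid_matroid C) (sfaces C).
Proof.
split; first split.
- exact: sfaces_complex.
- by move=> s x Ds _; apply: sfaces_extended_rank_lt.
move=> s x Ds sx /=; rewrite (extended_rank_face Ds) => exs Dxs t.
rewrite extended_rank_face // in exs.
rewrite !inE => /andP[/eqP ts0 Dts].
(* [setUUl] splits [(x |: t) :|: s] into the faces [x |: s] and [t :|: s], both containing [s]. *)
rewrite setUUl (sfaces_union_rank_eq (s := s)) ?subsetUr // andbT.
by rewrite setIUl ts0 setU0 setI_eq0 disjoints1.
Qed.
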